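(* Consider a $[pqrs]$ random walk on $[a,\infty)$ ($a\in\mathbb{Z}$), where $a$ is an absorbing barrier, started in an integer $i_0>a$. The probability of absorption in the barrier $a$ is $$x_a=\xi_1^{a-i_0},$$ and for every $n>a$ the probability of absorption in state $n$ is $s\,x_n$, where the expected number of visits $x_n$ is $$x_n=\begin{cases}\zeta\,\xi_1^{a-i_0}(\xi_1^{n-a}-\xi_2^{n-a}) & (a+1\le n\le i_0),\\ \zeta\,\xi_2^{n-a}(\xi_2^{a-i_0}-\xi_1^{a-i_0}) & (n\ge i_0).\end{cases}$$
   Context: Let $p,q,s>0$, $r\ge0$ with $p+q+r+s=1$. A $[pqrs]$ random walk on an interval of integers: in each state $n$ that is not an absorbing barrier, at each time unit the walk moves to $n+1$ with probability $p$, moves to $n-1$ with probability $q$, stays in $n$ for a time unit with probability $r$, and with probability $s$ is absorbed in the current state $n$ (the process terminates there). When the walk reaches an absorbing barrier it is absorbed there (the process terminates). $x_n$ denotes the expected number of visits to state $n$ when starting in $i_0$ (time $0$ counted; reaching a barrier counts as one visit). Notation: $$\xi_1=\frac{(1-r)+\sqrt{(1-r)^2-4pq}}{2q},\quad \xi_2=\frac{(1-r)-\sqrt{(1-r)^2-4pq}}{2q},\quad \zeta=\left[(1-r)^2-4pq\right]^{-1/2};$$ one has $\xi_1>1>\xi_2>0$. *)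

(* Defs.v *)
From mathcomp Require Import all_boot all_order all_algebra.
From mathcomp Require Import all_classical all_reals all_analysis.

Set Implicit Arguments.
Unset Strict Implicit.
Unset Printing Implicit Defensive.

Import Order.TTheory GRing.Theory Num.Theory.

Local Open Scope classical_set_scope.
Local Open Scope ring_scope.

(* [Live n]: the walk is in state n and the process has not terminated yet;
   [Dead n]: the process has terminated, the walk having been absorbed in n. *)
Inductive state := Live of int | Dead of int.

(* One-step transition probabilities.  A barrier is entered as [Live b], which
   counts as a visit, and the process terminates at the next time unit, so that
   a barrier is visited at most once.  For a walk started inside an interval
   whose finite endpoints are barriers, the states outside the interval are
   never reached, whence their transition law is irrelevant. *)
Definition pqrs_trans (R : realType) (p q r s : R) (barrier : pred int)
    (x y : state) : R :=
  match x, y with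
  | Live i, Live j =>
      if barrier i then 0
      else if j == i + 1 then p
      else if j == i - 1 then q
      else if j == i then r
      else 0
  | Live i, Dead j =>
      if j == i then (if barrier i then 1 else s) else 0
  | Dead _, Live _ => 0
  | Dead i, Dead j => if j == i then 1 else 0
  end.

(* [walk_step] is the Markov property, with the conditional probability given
   the history X_0 = h_0, ..., X_k = h_k multiplied out. *)
Record pqrs_walk (R : realType) (p q r s : R) (barrier : pred int) (i0 : int)
    (d : measure_display) (T : measurableType d) (P : probability T R)
    (X : nat -> T -> state) : Prop := PqrsWalk {
  walk_measurable : forall (k : nat) (x : state),
    measurable [set w | X k w = x] ;
  walk_init : P [set w | X 0%N w = Live i0] = 1%E ;
  walk_step : forall (k : nat) (h : nat -> state) (y : state),
    P [set w | (forall i, (i <= k)%N -> X i w = h i) /\ X k.+1 w = y]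
    = (P [set w | forall i, (i <= k)%N -> X i w = h i]
       * (pqrs_trans p q r s barrier (h k) y)%:E)%E
}.

Definition expected_visits (R : realType) (d : measure_display)
    (T : measurableType d) (P : probability T R) (X : nat -> T -> state)
    (n : int) : \bar R :=
  (\int[P]_w \sum_(0 <= k <oo) (\1_[set w' | X k w' = Live n] w)%:E)%E.

Definition absorption_prob (R : realType) (d : measure_display)
    (T : measurableType d) (P : probability T R) (X : nat -> T -> state)
    (n : int) : \bar R :=
  P [set w | exists k, X k w = Dead n].

Definition discr (R : realType) (p q r : R) : R := (1 - r) ^+ 2 - 4 * p * q.

Definition xi1 (R : realType) (p q r : R) : R :=
  ((1 - r) + Num.sqrt (discr p q r)) / (2 * q).

Definition xi2 (R : realType) (p q r : R) : R :=
  ((1 - r) - Num.sqrt (discr p q r)) / (2 * q).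

Definition zeta (R : realType) (p q r : R) : R :=
  (Num.sqrt (discr p q r))^-1.

(* Main.v *)
Require Import Defs.
From HB Require Import structures.
From mathcomp Require Import all_boot all_order all_algebra.
From mathcomp Require Import all_classical all_reals all_analysis.
From mathcomp Require Import measurable_realfun.
From mathcomp Require Import ring lra zify.

(** Why the theorem holds.

    Write x_n for the expected number of visits to n, that is, the sum over
    the times k of P(X_k = n, not yet terminated).  Conditioning on the
    previous state, the Chapman-Kolmogorov step [live_one_step] gives, after
    summation over k, the balance equation of [visits_balance]:

      x_n = [n = i0] + p x_(n-1) + r x_n + q x_(n+1)    for n > a,

    where x_a has to be replaced by 0, because the walk never leaves a alive.
    Termination in n happens exactly from a visit to n, with probability s
    (or 1 at the barrier), and a terminated process stays where it is; so the
    events X_k = (terminated in n) increase with k up to null sets and the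
    absorption probability is s x_n, or x_a at the barrier
    ([absorption_visits]).  As s x_n is a probability, x_n <= 1/s.

    Boundedness singles out the solution of the balance equation.  For a
    difference z of two bounded solutions, z_a = 0 and
    |z_n| <= (p + q) / (1 - r) sup |z|, with (p + q) / (1 - r) < 1 as s > 0, so
    z = 0 ([bounded_balanced_eq0]).  It remains to exhibit one bounded solution.
    The sequence e_m = zeta (xi1^m - xi2^m) solves the homogeneous recurrence
    with e_0 = 0 and q e_1 = 1, so that

      xi1^(a-i0) e_(n-a) - [n > i0] e_(n-i0)

    vanishes at a and has exactly the unit source at i0; the coefficient
    xi1^(a-i0) is the one that cancels the growing powers of xi1 beyond i0
    ([green_balance], [green_bound]).  This is the announced formula.  At the
    barrier the balance equation reads x_a = q x_(a+1), which is
    xi1^(a-i0). *)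

Set Implicit Arguments.
Unset Strict Implicit.
Unset Printing Implicit Defensive.

Import Order.TTheory GRing.Theory Num.Theory.

Local Open Scope classical_set_scope.
Local Open Scope ring_scope.

(** * Discrete-time Markov chains on a countable state space *)

(** Countable additivity over the fibers of [Y], in a form that avoids writing
    the series over the state space.  Taking [c = 0] shows that a set is null as
    soon as all its slices along [Y] are. *)
Lemma measure_proportional_on_fibers (R : realType) (d : measure_display)
    (T : measurableType d) (mu : {measure set T -> \bar R}) (S : countType)
    (Y : T -> S) (A B : set T) (c : R) :
  (forall x, measurable [set w | Y w = x]) -> measurable A -> measurable B ->
  (forall x, mu (A `&` [set w | Y w = x])
             = c%:E * mu (B `&` [set w | Y w = x]))%E ->
  (mu A = c%:E * mu B)%E.
Proof.
move=> mY mA mB AB.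
pose F n := [set w | pickle (Y w) = n].
have FE n : F n = set0 \/ exists x, F n = [set w | Y w = x].
  case: (pselect (exists x : S, pickle x = n)) => [[x <-]|nx].
    right; exists x; rewrite /F; apply/seteqP; split => w /=.
      exact: (pcan_inj pickleK).
    by move=> ->.
  by left; rewrite -subset0 => w Fw; apply: nx; exists (Y w).
have mF n : measurable (F n).
  by case: (FE n) => [->|[x ->]]; [exact: measurable0|exact: mY].
have total C : measurable C -> mu C = (\sum_(0 <= n <oo) mu (C `&` F n))%E.
  move=> mC; have {1}-> : C = \bigcup_n (C `&` F n).
    by rewrite -setI_bigcupr setIidl// => w _; exists (pickle (Y w)).
  rewrite measure_bigcup.
  - by apply: eq_eseriesl => n; rewrite in_setT.
  - by move=> n _; exact: measurableI.
  - by move=> m n _ _ [w [[_ <-] [_ <-]]].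
rewrite (total A)// (total B)// -nneseriesZl; last by [].
apply: eq_eseriesr => n _; case: (FE n) => [->|[x ->]]; last exact: AB.
by rewrite !setI0 measure0 mule0.
Qed.

(** The Markov property given the whole history implies the one given the
    current state: the coordinates 0, 1, ..., k - 1 of the history are summed
    out one at a time, the transition probability being a constant factor as it
    depends only on the last coordinate. *)
Lemma markov_current_state (R : realType) (d : measure_display)
    (T : measurableType d) (P : probability T R) (S : countType)
    (X : nat -> T -> S) (K : S -> S -> R) :
  (forall k x, measurable [set w | X k w = x]) ->
  (forall k (h : nat -> S) y,
    P [set w | (forall i, (i <= k)%N -> X i w = h i) /\ X k.+1 w = y]
    = (P [set w | forall i, (i <= k)%N -> X i w = h i] * (K (h k) y)%:E)%E) ->
  forall k x y,
    P ([set w | X k.+1 w = y] `&` [set w | X k w = x])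
    = ((K x y)%:E * P [set w | X k w = x])%E.
Proof.
move=> mX step k x y.
pose H j (h : nat -> S) := [set w | forall i, (j <= i <= k)%N -> X i w = h i].
have mH j h : measurable (H j h).
  have -> : H j h = \bigcap_i
      (if (j <= i <= k)%N then [set w | X i w = h i] else setT).
    apply/seteqP; split => w /= Hw i; first by move=> _; case: ifP => // /Hw.
    by move=> ijk; have := Hw i I; rewrite ijk.
  apply: bigcapT_measurable => i; case: ifP => _; first exact: mX.
  exact: measurableT.
have claim j : (j <= k)%N -> forall h,
    P ([set w | X k.+1 w = y] `&` H j h) = ((K (h k) y)%:E * P (H j h))%E.
  elim: j => [_ h|j IH jk h].
    rewrite [RHS]muleC setIC; exact: step.
  apply: (@measure_proportional_on_fibers _ _ _ _ _ (X j)) => //.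
    exact: measurableI.
  (* The slice of the event along X_j = z fixes the history from time j on. *)
  move=> z; pose h' i := if i == j then z else h i.
  have HE : H j.+1 h `&` [set w | X j w = z] = H j h'.
    apply/seteqP; split => w /=.
      move=> [Hw Xj] i /andP[ji ik]; rewrite /h'; case: eqVneq => [->//|nij].
      by apply: Hw; rewrite ik andbT ltn_neqAle eq_sym nij.
    move=> Hw; split=> [i /andP[ji ik]|].
      by rewrite Hw ?(ltnW ji)// /h' gtn_eqF.
    by rewrite Hw ?leqnn ?(ltnW jk)// /h' eqxx.
  have := IH (ltnW jk) h'.
  by rewrite -HE setIA {1}/h' gtn_eqF.
have Hk : H k (fun=> x) = [set w | X k w = x].
  apply/seteqP; split => w /= Hw; first by apply: Hw; rewrite leqnn.
  by move=> i; rewrite -eqn_leq => /eqP <-.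
by have := claim k (leqnn k) (fun=> x); rewrite Hk.
Qed.

(** The list [L] contains all states from which [y] can be reached in one step,
    which turns the Chapman-Kolmogorov series into a finite sum. *)
Lemma markov_one_step (R : realType) (d : measure_display)
    (T : measurableType d) (P : probability T R) (S : countType)
    (X : nat -> T -> S) (K : S -> S -> R) (k : nat) (y : S) (L : seq S) :
  (forall k x, measurable [set w | X k w = x]) ->
  (forall x, P ([set w | X k.+1 w = y] `&` [set w | X k w = x])
             = (K x y)%:E * P [set w | X k w = x])%E ->
  uniq L -> (forall x, x \notin L -> K x y = 0) ->
  P [set w | X k.+1 w = y]
  = (\sum_(x <- L) (K x y)%:E * P [set w | X k w = x])%E.
Proof.
move=> mX XK uL K0; set A := [set w | X k.+1 w = y].
have mA : measurable A by exact: mX.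
have mB (L' : seq S) : measurable [set w | X k w \in L'].
  elim: L' => [|x L' mL'].
    by rewrite (_ : [set _ | _] = set0)// -subset0.
  have -> : [set w | X k w \in x :: L']
          = [set w | X k w = x] `|` [set w | X k w \in L'].
    apply/seteqP; split => w /=; rewrite inE.
      by case/orP => [/eqP|]; [left|right].
    by case=> [->|->]; rewrite ?eqxx ?orbT.
  by apply: measurableU.
have out : P (A `\` [set w | X k w \in L]) = 0.
  have mAL : measurable (A `\` [set w | X k w \in L]) by exact: measurableD.
  rewrite -[RHS](mul0e (P A)).
  apply: (@measure_proportional_on_fibers _ _ _ _ _ (X k)) => // x.
  rewrite mul0e; have [xL|xL] := boolP (x \in L).
    rewrite (_ : _ `&` _ = set0) ?measure0// -subset0 => w [[_ nXL] Xx].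
    by apply: nXL; rewrite /= Xx.
  apply: (@subset_measure0 _ _ _ _ _ (A `&` [set w | X k w = x])).
  - exact: measurableI.
  - exact: measurableI.
  - by move=> w [[Aw _] Xw]; split.
  - by have := XK x; rewrite K0// mul0e.
have -> : P A = P (A `&` [set w | X k w \in L]).
  by rewrite -[RHS]add0e -out; exact: measureDI.
clear out K0.
elim: L uL => [_|x L IH /= /andP[xL uL]].
  by rewrite big_nil (_ : _ `&` _ = set0) ?measure0// -subset0 => w [].
rewrite big_cons -XK -(IH uL); etransitivity; last apply: measureU.
- congr (P _); rewrite -setIUr; congr (_ `&` _).
  apply/seteqP; split => w /=; rewrite inE.
    by case/orP => [/eqP|]; [left|right].
  by case=> [->|->]; rewrite ?eqxx ?orbT.
- exact: measurableI.
- exact: measurableI.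
- by rewrite -subset0 => w [[_ /= Xx] [_ /= XL]]; move: xL; rewrite -Xx XL.
Qed.

(** Continuity from below, with inclusions up to null sets: the partial unions
    of the [D k] do increase, and they exceed [D k] by a null set only. *)
Lemma cvg_measure_ae_nondecreasing (R : realType) (d : measure_display)
    (T : measurableType d) (mu : {measure set T -> \bar R})
    (D : nat -> set T) :
  (forall k, measurable (D k)) -> (forall k, mu (D k `\` D k.+1) = 0)%E ->
  (mu (D k) @[k --> \oo] --> mu (\bigcup_k D k))%E.
Proof.
move=> mD D0; pose E k := \bigcup_(j < k.+1) D j.
have mE k : measurable (E k) by exact: bigcup_measurable.
have ES k : E k.+1 = E k `|` D k.+1.
  by rewrite /E !bigcup_mkord big_ord_recr.
have DE k : D k `<=` E k by move=> w Dw; exists k => /=.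
have ED0 k : mu (E k `\` D k) = 0%E.
  elim: k => [|k IH]; first by rewrite /E bigcup_mkord big_ord1 setDv measure0.
  apply: (@subset_measure0 _ _ _ _ _ ((E k `\` D k) `|` (D k `\` D k.+1))).
  - exact: measurableD.
  - by apply: measurableU; exact: measurableD.
  - move=> w [] + nD; rewrite ES => -[Ew|//].
    by have [Dw|nDw] := pselect (D k w); [right|left].
  - apply/eqP; rewrite eq_le measure_ge0 andbT.
    have : (mu (E k `\` D k) + mu (D k `\` D k.+1) <= 0)%E.
      by rewrite IH D0 adde0.
    by apply: le_trans; apply: measureU2; exact: measurableD.
have muE k : mu (D k) = mu (E k).
  have -> : (mu (E k) = mu (E k `\` D k) + mu (E k `&` D k))%E.
    exact: measureDI.
  by rewrite ED0 add0e setIidr.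
rewrite (eq_cvg _ _ muE).
have -> : \bigcup_k D k = \bigcup_k E k.
  apply/seteqP; split => w [k _ Dw]; first by exists k => //; exact: DE.
  by case: Dw => j _ Dw; exists j.
apply: nondecreasing_cvg_mu => //; first exact: bigcup_measurable.
move=> m n mn; apply/subsetPset => w [j jm Dw]; exists j => //=.
exact: leq_trans (mn : (m.+1 <= n.+1)%N).
Qed.

(** * Visits and absorption of the walk *)

Definition sum_of_state (x : state) : int + int :=
  match x with Live n => inl n | Dead n => inr n end.

Definition state_of_sum (u : int + int) : state :=
  match u with inl n => Live n | inr n => Dead n end.

Lemma sum_of_stateK : cancel sum_of_state state_of_sum.
Proof. by case. Qed.

HB.instance Definition _ := Countable.copy state (can_type sum_of_stateK).

Lemma eq_Live (m n : int) : (Live m == Live n) = (m == n).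
Proof. by apply/eqP/eqP => [[]|->]. Qed.

Lemma eq_Dead (m n : int) : (Dead m == Dead n) = (m == n).
Proof. by apply/eqP/eqP => [[]|->]. Qed.

Lemma walk_initial_law (R : realType) (p q r s : R) (barrier : pred int)
    (i0 : int) (d : measure_display) (T : measurableType d)
    (P : probability T R) (X : nat -> T -> state) (x : state) :
  pqrs_walk p q r s barrier i0 P X ->
  P [set w | X 0%N w = x] = ((x == Live i0)%:R)%:E.
Proof.
move=> hX; have [->|xi] := eqVneq x (Live i0); first exact: walk_init hX.
apply: (@subset_measure0 _ _ _ _ _ (~` [set w | X 0%N w = Live i0])).
- exact: walk_measurable hX _ _.
- by apply: measurableC; exact: walk_measurable hX _ _.
- by move=> w /= ->; apply/eqP.
- have : P (~` [set w | X 0%N w = Live i0]) = 0%E.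
    rewrite probability_setC ?(walk_init hX) ?subee//.
    exact: walk_measurable hX _ _.
  by [].
Qed.

Lemma walk_current_state (R : realType) (p q r s : R) (barrier : pred int)
    (i0 : int) (d : measure_display) (T : measurableType d)
    (P : probability T R) (X : nat -> T -> state) :
  pqrs_walk p q r s barrier i0 P X -> forall k x y,
  P ([set w | X k.+1 w = y] `&` [set w | X k w = x])
  = ((pqrs_trans p q r s barrier x y)%:E * P [set w | X k w = x])%E.
Proof.
move=> hX; apply: (markov_current_state (walk_measurable hX)).
exact: walk_step hX.
Qed.

Lemma live_one_step (R : realType) (p q r s : R) (barrier : pred int)
    (i0 : int) (d : measure_display) (T : measurableType d)
    (P : probability T R) (X : nat -> T -> state) (k : nat) (n : int) :
  pqrs_walk p q r s barrier i0 P X ->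
  P [set w | X k.+1 w = Live n]
  = ((if barrier (n - 1) then 0 else p)%:E * P [set w | X k w = Live (n - 1)]
     + (if barrier n then 0 else r)%:E * P [set w | X k w = Live n]
     + (if barrier (n + 1) then 0 else q)%:E
       * P [set w | X k w = Live (n + 1)])%E.
Proof.
move=> hX.
rewrite (@markov_one_step _ _ _ P _ X _ k (Live n)
  [:: Live (n - 1); Live n; Live (n + 1)] (walk_measurable hX)
  (fun x => walk_current_state hX k x (Live n))).
- rewrite !big_cons big_nil adde0 addeA /= subrK eqxx.
  have -> : (n == n + 1) = false by lia.
  have -> : (n == n - 1) = false by lia.
  have -> : (n == n + 1 + 1) = false by lia.
  by rewrite addrK !eqxx.
- by rewrite /= !inE !eq_Live; lia.
- case=> m //=; rewrite !inE !eq_Live => /norP[m1 /norP[m0 m2]].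
  have -> : (n == m + 1) = false by lia.
  have -> : (n == m - 1) = false by lia.
  have -> : (n == m) = false by lia.
  by case: ifP.
Qed.

Lemma dead_one_step (R : realType) (p q r s : R) (barrier : pred int)
    (i0 : int) (d : measure_display) (T : measurableType d)
    (P : probability T R) (X : nat -> T -> state) (k : nat) (n : int) :
  pqrs_walk p q r s barrier i0 P X ->
  P [set w | X k.+1 w = Dead n]
  = ((if barrier n then 1 else s)%:E * P [set w | X k w = Live n]
     + P [set w | X k w = Dead n])%E.
Proof.
move=> hX.
rewrite (@markov_one_step _ _ _ P _ X _ k (Dead n)
  [:: Live n; Dead n] (walk_measurable hX)
  (fun x => walk_current_state hX k x (Dead n))) //.
- by rewrite !big_cons big_nil adde0 /= eqxx mul1e.
- case=> m; rewrite !inE ?eq_Live ?eq_Dead /=.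
    by rewrite orbF eq_sym => /negbTE ->.
  by rewrite eq_sym => /negbTE ->.
Qed.

Lemma expected_visitsE (R : realType) (d : measure_display)
    (T : measurableType d) (P : probability T R) (X : nat -> T -> state)
    (n : int) :
  (forall k x, measurable [set w | X k w = x]) ->
  expected_visits P X n = (\sum_(0 <= k <oo) P [set w | X k w = Live n])%E.
Proof.
move=> mX; rewrite /expected_visits integral_nneseries//.
- by apply: eq_eseriesr => k _; rewrite integral_indic// setIT.
- by move=> k; apply/measurable_EFinP; exact: measurable_indic.
Qed.

(** Every visit is the one at time 0 or is preceded, one time unit earlier, by
    a visit to a state which is not a barrier and at distance at most 1. *)
Lemma visits_balance (R : realType) (p q r s : R) (barrier : pred int)
    (i0 : int) (d : measure_display) (T : measurableType d)
    (P : probability T R) (X : nat -> T -> state) (n : int) :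
  0 <= p -> 0 <= q -> 0 <= r ->
  pqrs_walk p q r s barrier i0 P X ->
  expected_visits P X n
  = ((n == i0)%:R%:E
     + ((if barrier (n - 1) then 0 else p)%:E * expected_visits P X (n - 1)
        + (if barrier n then 0 else r)%:E * expected_visits P X n
        + (if barrier (n + 1) then 0 else q)%:E
          * expected_visits P X (n + 1)))%E.
Proof.
move=> hp hq hr hX; have mX := walk_measurable hX.
have ge0 c m k : 0 <= c -> (0 <= (if barrier m then 0 else c)%:E
                              * P [set w | X k w = Live m])%E.
  by move=> c0; rewrite mule_ge0// lee_fin; case: ifP.
rewrite {1}(expected_visitsE P n mX) nneseries_recl//.
rewrite (walk_initial_law _ hX) eq_Live; congr (_ + _)%E.
rewrite -(@nneseries_addn _ _ 1) //.
under eq_eseriesr do rewrite addn1 (live_one_step _ _ hX).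
rewrite nneseriesD; last 2 first.
- by move=> k _ _; rewrite adde_ge0// ge0.
- by move=> k _ _; rewrite ge0.
rewrite nneseriesD; last 2 first.
- by move=> k _ _; rewrite ge0.
- by move=> k _ _; rewrite ge0.
by rewrite !nneseriesZl// !expected_visitsE.
Qed.

(** Termination is irreversible, so the probability of being absorbed in [n] is
    the limit of the probability of being absorbed in [n] by time k.  That one
    grows at each time unit by the probability of a visit, times the probability
    that the visit is the last one. *)
Lemma absorption_visits (R : realType) (p q r s : R) (barrier : pred int)
    (i0 : int) (d : measure_display) (T : measurableType d)
    (P : probability T R) (X : nat -> T -> state) (n : int) :
  0 <= s -> pqrs_walk p q r s barrier i0 P X ->
  absorption_prob P X n
  = ((if barrier n then 1 else s)%:E * expected_visits P X n)%E.
Proof.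
move=> s0 hX; have mX := walk_measurable hX.
set c := (if barrier n then 1 else s).
have c0 : 0 <= c by rewrite /c; case: ifP.
rewrite expected_visitsE// -nneseriesZl//.
have Dsum k : P [set w | X k w = Dead n]
    = (\sum_(0 <= j < k) c%:E * P [set w | X j w = Live n])%E.
  elim: k => [|k IH]; first by rewrite big_nil (walk_initial_law _ hX).
  by rewrite (dead_one_step _ _ hX) big_nat_recr//= addeC IH.
have limD : P [set w | X k w = Dead n] @[k --> \oo] --> absorption_prob P X n.
  rewrite /absorption_prob.
  have -> : [set w | exists k, X k w = Dead n]
      = \bigcup_k [set w | X k w = Dead n].
    by apply/seteqP; split => w [k]; exists k.
  apply: cvg_measure_ae_nondecreasing => // k.
  (* From [Dead n], any state other than [Dead n] has probability 0. *)
  rewrite -(mul0e (P [set w | X k w = Dead n])).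
  apply: (@measure_proportional_on_fibers _ _ _ _ _ (X k.+1)) => //.
    exact: measurableD.
  move=> x; rewrite mul0e; have [->|xn] := eqVneq x (Dead n).
    by rewrite (_ : _ `&` _ = set0) ?measure0// -subset0 => w [[]].
  apply: (@subset_measure0 _ _ _ _ _
    ([set w | X k.+1 w = x] `&` [set w | X k w = Dead n])) => //.
  - by apply: measurableI => //; exact: measurableD.
  - exact: measurableI.
  - by move=> w [[? ?] ?].
  - have := walk_current_state hX k (Dead n) x; rewrite /pqrs_trans.
    by case: x xn => m; rewrite ?eq_Dead ?mul0e// => /negbTE ->; rewrite mul0e.
rewrite (eq_cvg _ _ Dsum) in limD.
apply: (cvg_unique _ limD) => //.
by apply: is_cvg_nneseries => k _ _; rewrite mule_ge0// lee_fin.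
Qed.

(** * The balance equation *)

Lemma discr_gt0 (R : realType) (p q r s : R) :
  0 < p -> 0 < q -> 0 < s -> p + q + r + s = 1 -> 0 < discr p q r.
Proof.
move=> hp hq hs hsum; rewrite /discr (_ : 1 - r = p + q + s); last by lra.
(* (p + q + s)^2 - 4 p q, arranged so as to show its sign. *)
rewrite (_ : _ - _ = (p - q) ^+ 2 + s * (2 * (p + q) + s)); last by ring.
rewrite ltr_wpDl ?sqr_ge0// mulr_gt0//; lra.
Qed.

(** The polynomial q x^2 - (1 - r) x + p takes the negative value - s at 1, so
    that 1 separates its roots; their product p / q is positive. *)
Lemma xi_bounds (R : realType) (p q r s : R) :
  0 < p -> 0 < q -> 0 < s -> p + q + r + s = 1 ->
  0 < xi2 p q r < 1 /\ 1 < xi1 p q r.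
Proof.
move=> hp hq hs hsum.
have D0 := discr_gt0 hp hq hs hsum.
set t := Num.sqrt (discr p q r).
have t0 : 0 < t by rewrite sqrtr_gt0.
have t2 : t ^+ 2 = (1 - r) ^+ 2 - 4 * p * q by rewrite sqr_sqrtr// ltW.
rewrite /xi1 /xi2 -/t.
by rewrite divr_gt0 ?ltr_pdivrMr ?ltr_pdivlMr; try nra; split; nra.
Qed.

(** The solution of the homogeneous recurrence with values 0 at 0 and 1/q at 1;
    subtracting it from some point on creates a unit source there. *)
Definition fund (R : realType) (p q r : R) (m : int) : R :=
  zeta p q r * (xi1 p q r ^ m - xi2 p q r ^ m).

Lemma fund0 (R : realType) (p q r : R) : fund p q r 0 = 0.
Proof. by rewrite /fund !expr0z subrr mulr0. Qed.

Lemma fund1 (R : realType) (p q r s : R) :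
  0 < p -> 0 < q -> 0 < s -> p + q + r + s = 1 -> q * fund p q r 1 = 1.
Proof.
move=> hp hq hs hsum; have D0 := discr_gt0 hp hq hs hsum.
rewrite /fund !expr1z /zeta /xi1 /xi2.
have : Num.sqrt (discr p q r) != 0 by rewrite gt_eqF// sqrtr_gt0.
move: (Num.sqrt _) => t t0; field; rewrite t0 andbT; lra.
Qed.

Lemma fund_balance (R : realType) (p q r s : R) (m : int) :
  0 < p -> 0 < q -> 0 < s -> p + q + r + s = 1 ->
  (1 - r) * fund p q r m = p * fund p q r (m - 1) + q * fund p q r (m + 1).
Proof.
move=> hp hq hs hsum; have [/andP[x20 _] x11] := xi_bounds hp hq hs hsum.
have D0 := discr_gt0 hp hq hs hsum.
set t := Num.sqrt (discr p q r).
have t2 : t ^+ 2 = (1 - r) ^+ 2 - 4 * p * q by rewrite sqr_sqrtr// ltW.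
(* [u] stands for the two square roots of the discriminant. *)
have root u x : u ^+ 2 = t ^+ 2 -> x = (1 - r + u) / (2 * q) ->
    (1 - r) * x = p + q * x ^+ 2.
  move=> u2 xE.
  suff : 4 * q * ((1 - r) * x) = 4 * q * (p + q * x ^+ 2).
    by apply: mulfI; lra.
  rewrite mulrDr (_ : 4 * q * (q * _) = (2 * q * x) ^+ 2); last by ring.
  rewrite (_ : 4 * q * _ = 2 * (1 - r) * (2 * q * x)); last by ring.
  have -> : 2 * q * x = 1 - r + u by rewrite xE; field; lra.
  by rewrite sqrrD u2 t2; ring.
have root1 := root t (xi1 p q r) erefl erefl.
have root2 := root (- t) (xi2 p q r) (sqrrN t) erefl.
have geo x : x != 0 -> (1 - r) * x = p + q * x ^+ 2 ->
    (1 - r) * x ^ m = p * x ^ (m - 1) + q * x ^ (m + 1).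
  move=> x0 xE; have [k ->] : exists k, m = k + 1 by exists (m - 1); lia.
  rewrite addrK -addrA !(expfzDr _ _ x0) expr1z.
  by rewrite mulrCA xE; ring.
rewrite /fund.
rewrite mulrCA mulrBr (geo _ (lt0r_neq0 (lt_trans ltr01 x11)) root1).
by rewrite (geo _ (lt0r_neq0 x20) root2); ring.
Qed.

(** A maximum principle: the recurrence bounds [z n] by c = (p + q) / (1 - r)
    times a bound for its neighbours, and c < 1.  Iterating it, [`|z n|] is at
    most M c^k for every k. *)
Lemma bounded_balanced_eq0 (R : realType) (p q r s : R) (a : int)
    (z : int -> R) (M : R) :
  0 < p -> 0 < q -> 0 < s -> p + q + r + s = 1 ->
  z a = 0 -> (forall n, a <= n -> `|z n| <= M) ->
  (forall n, a < n -> (1 - r) * z n = p * z (n - 1) + q * z (n + 1)) ->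
  forall n, a <= n -> z n = 0.
Proof.
move=> hp hq hs hsum za zM bal n an.
have r1 : 0 < 1 - r by lra.
pose c := (p + q) / (1 - r).
have c01 : `|c| < 1 by rewrite ger0_norm ?divr_ge0 ?ltr_pdivrMr; lra.
have zc k m : a <= m -> `|z m| <= M * c ^+ k.
  elim: k m => [|k IH] m am; first by rewrite expr0 mulr1; exact: zM.
  move: am; rewrite le_eqVlt => /predU1P[<-|am].
    rewrite za normr0 mulr_ge0//; first exact: le_trans (zM _ (lexx a)).
    by rewrite exprn_ge0// divr_ge0//; lra.
  rewrite exprS mulrCA /c mulrAC ler_pdivlMr// -(ger0_norm (ltW r1)) -normrM.
  rewrite mulrC bal// mulrDl (le_trans (ler_normD _ _))// !normrM.
  rewrite (gtr0_norm hp) (gtr0_norm hq) (gtr0_norm r1).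
  by rewrite lerD// ler_pM2l// IH; lia.
have lim0 := cvg_geometric M c01.
apply/eqP; rewrite -normr_le0; apply: (cvgr_to_ge lim0).
by apply: nearW => k; exact: zc.
Qed.

(** The Green function of the walk killed at [a], i.e. the expected number of
    visits to [n] from [i0].  The two cases of the formula for it differ by
    [fund] centered at [i0]; with this encoding the recurrence is checked
    once for all [n], separately from the values. *)
Definition green (R : realType) (p q r : R) (a i0 n : int) : R :=
  xi1 p q r ^ (a - i0) * fund p q r (n - a)
  - (if i0 < n then fund p q r (n - i0) else 0).

Lemma green_le (R : realType) (p q r : R) (a i0 n : int) : n <= i0 ->
  green p q r a i0 n = zeta p q r * xi1 p q r ^ (a - i0)
                       * (xi1 p q r ^ (n - a) - xi2 p q r ^ (n - a)).
Proof. by move=> ni; rewrite /green ltNge ni /= subr0 mulrCA mulrA. Qed.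

Lemma green_ge (R : realType) (p q r : R) (a i0 n : int) :
  xi1 p q r != 0 -> xi2 p q r != 0 -> i0 <= n ->
  green p q r a i0 n = zeta p q r * xi2 p q r ^ (n - a)
                       * (xi2 p q r ^ (a - i0) - xi1 p q r ^ (a - i0)).
Proof.
move=> x1 x2 ni.
have -> : green p q r a i0 n
    = xi1 p q r ^ (a - i0) * fund p q r (n - a) - fund p q r (n - i0).
  by rewrite /green; case: ltgtP ni => // -> _; rewrite subrr fund0.
have split (x : R) : x != 0 -> x ^ (n - i0) = x ^ (n - a) * x ^ (a - i0).
  by move=> x0; rewrite -expfzDr// addrA subrK.
by rewrite /fund !split//; ring.
Qed.

Lemma green_balance (R : realType) (p q r s : R) (a i0 n : int) :
  0 < p -> 0 < q -> 0 < s -> p + q + r + s = 1 ->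
  (1 - r) * green p q r a i0 n
  = (n == i0)%:R + p * green p q r a i0 (n - 1) + q * green p q r a i0 (n + 1).
Proof.
move=> hp hq hs hsum; rewrite /green.
have F := fund_balance _ hp hq hs hsum.
have -> : (n - 1 - a = n - a - 1)%R by ring.
have -> : (n + 1 - a = n - a + 1)%R by ring.
have -> : (n - 1 - i0 = n - i0 - 1)%R by ring.
have -> : (n + 1 - i0 = n - i0 + 1)%R by ring.
rewrite mulrBr mulrCA F.
have [ni|ni|->] := ltgtP n i0.
- have -> : (i0 < n - 1) = false by lia.
  have -> : (i0 < n + 1) = false by lia.
  by rewrite /=; ring.
- have -> : (i0 < n + 1) by lia.
  rewrite F /=; have [n1|n1] := ltP i0 (n - 1); first by ring.
  have -> : n - i0 = 1 by lia.
  by rewrite subrr fund0; ring.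
- have -> : (i0 < i0 - 1) = false by lia.
  have -> : (i0 < i0 + 1) by lia.
  rewrite /= (_ : true%:R = q * fund p q r 1); last by rewrite (fund1 hp hq hs).
  by rewrite subrr add0r; ring.
Qed.

Lemma green_barrier (R : realType) (p q r : R) (a i0 : int) : a < i0 ->
  green p q r a i0 a = 0.
Proof. by move=> ai; rewrite /green subrr fund0 mulr0 ltNge ltW// subr0. Qed.

Lemma green_next_barrier (R : realType) (p q r s : R) (a i0 : int) :
  0 < p -> 0 < q -> 0 < s -> p + q + r + s = 1 -> a < i0 ->
  q * green p q r a i0 (a + 1) = xi1 p q r ^ (a - i0).
Proof.
move=> hp hq hs hsum ai; rewrite /green (_ : (i0 < a + 1) = false); last by lia.
by rewrite subr0 addrAC subrr add0r mulrCA (fund1 hp hq hs hsum) mulr1.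
Qed.

(** Before [i0] the growing power is xi1^(n-i0) <= 1, and after [i0] only
    xi2^(n-i0) <= 1 is left, since the powers of xi1 cancel. *)
Lemma green_bound (R : realType) (p q r s : R) (a i0 n : int) :
  0 < p -> 0 < q -> 0 < s -> p + q + r + s = 1 -> a < i0 -> a <= n ->
  `|green p q r a i0 n| <= zeta p q r.
Proof.
move=> hp hq hs hsum ai an.
have [/andP[x20 x21] x11] := xi_bounds hp hq hs hsum.
have x10 : 0 < xi1 p q r by lra.
have z0 : 0 <= zeta p q r by rewrite invr_ge0 sqrtr_ge0.
have ge1 m : 0 <= m -> 1 <= xi1 p q r ^ m.
  by case: m => // m _; rewrite -exprnP exprn_ege1// ltW.
have le1 m : 0 <= m -> 0 <= xi2 p q r ^ m <= 1.
  by case: m => // m _; rewrite -exprnP exprn_ge0 ?exprn_ile1// ltW.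
have bnd (x y : R) : 0 <= y <= 1 -> 0 <= x <= 1 ->
    `|zeta p q r * (x - y)| <= zeta p q r.
  move=> /andP[y0 y1] /andP[x0 x1].
  by rewrite normrM (ger0_norm z0) ler_piMr// ler_norml; lra.
have inv1 : 0 <= xi1 p q r ^ (a - i0) <= 1.
  rewrite (exprz_ge0 _ (ltW x10)) /= -[a - i0]opprB -invr_expz.
  rewrite invf_le1 ?exprz_gt0//.
  by apply: ge1; lia.
have [ni|ni] := leP n i0.
  rewrite green_le// -mulrA mulrBr; apply: bnd.
    have /andP[? ?] : 0 <= xi2 p q r ^ (n - a) <= 1 by apply: le1; lia.
    by case/andP: inv1 => ? ?; rewrite mulr_ge0// mulr_ile1.
  rewrite -expfzDr ?gt_eqF// (_ : a - i0 + (n - a) = - (i0 - n)); last by ring.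
  rewrite -invr_expz.
  rewrite invr_ge0 (exprz_ge0 _ (ltW x10)) /= invf_le1 ?exprz_gt0//.
  by apply: ge1; lia.
rewrite (green_ge _ (lt0r_neq0 x10) (lt0r_neq0 x20) (ltW ni)) -mulrA mulrBr.
apply: bnd.
  have /andP[? ?] : 0 <= xi2 p q r ^ (n - a) <= 1 by apply: le1; lia.
  by case/andP: inv1 => ? ?; rewrite mulr_ge0// mulr_ile1.
rewrite -expfzDr ?gt_eqF// addrA subrK; apply: le1; lia.
Qed.

(** * Visits of the walk on the half-line *)

(** The walk cannot jump over the barrier, nor leave it alive. *)
Lemma visits_below_barrier (R : realType) (p q r s : R)
    (a i0 : int) (d : measure_display) (T : measurableType d)
    (P : probability T R) (X : nat -> T -> state) (n : int) :
  a < i0 -> pqrs_walk p q r s (pred1 a) i0 P X -> n < a ->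
  expected_visits P X n = 0%E.
Proof.
move=> ai hX na; rewrite expected_visitsE; last exact: walk_measurable hX.
apply: eseries0 => k _ _; elim: k n na => [|k IH] n na.
  by rewrite (walk_initial_law _ hX) eq_Live (_ : (n == i0) = false)//; lia.
rewrite (live_one_step _ _ hX) (IH n na) (IH (n - 1)); last by lia.
rewrite !mule0 !add0e; have [->|nea] := eqVneq (n + 1) a.
  by rewrite /= eqxx mul0e.
by rewrite IH ?mule0//; lia.
Qed.

(** The expected visits and [green] are bounded solutions of one balance
    equation. *)
Lemma visits_eq_green (R : realType) (p q r s : R)
    (a i0 : int) (d : measure_display) (T : measurableType d)
    (P : probability T R) (X : nat -> T -> state) (n : int) :
  0 < p -> 0 < q -> 0 < s -> 0 <= r -> p + q + r + s = 1 ->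
  a < i0 -> pqrs_walk p q r s (pred1 a) i0 P X -> a < n ->
  expected_visits P X n = (green p q r a i0 n)%:E.
Proof.
move=> hp hq hs hr hsum ai hX.
have bal m := visits_balance m (ltW hp) (ltW hq) hr hX.
have vge0 m : (0 <= expected_visits P X m)%E.
  by rewrite expected_visitsE ?nneseries_ge0//; exact: walk_measurable hX.
have vle m : a < m -> (s%:E * expected_visits P X m <= 1)%E.
  move=> am; have := absorption_visits m (ltW hs) hX.
  rewrite /= gt_eqF// => <-; apply: probability_le1.
  rewrite (_ : [set w | _] = \bigcup_k [set w | X k w = Dead m]).
    by apply: bigcup_measurable => k _; exact: walk_measurable hX _ _.
  by apply/seteqP; split => w [k]; exists k.
have vfin m : a < m -> exists2 x : R, expected_visits P X m = x%:E
    & 0 <= x <= s^-1.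
  move=> am; have := vle m am; have := vge0 m.
  case: (expected_visits P X m) => [x|_|//].
    rewrite -EFinM !lee_fin => x0 sx; exists x => //.
    by rewrite x0 -[s^-1]mulr1 ler_pdivlMl.
  by rewrite gt0_muley ?lte_fin.
(* The value at [a] is set to 0 because visits to the barrier do not feed its
   neighbour. *)
pose v m := if m == a then 0 else fine (expected_visits P X m).
have vE m : a < m -> expected_visits P X m = (v m)%:E.
  by move=> am; rewrite /v gt_eqF//; have [x -> _] := vfin m am.
have vterm c m : a <= m ->
    ((if pred1 a m then 0 else c)%:E * expected_visits P X m = (c * v m)%:E)%E.
  rewrite le_eqVlt => /predU1P[<-|am]; first by rewrite /v /= eqxx mul0e mulr0.
  by rewrite vE// /= gt_eqF.
have vbal m : a < m ->
    (1 - r) * v m = (m == i0)%:R + p * v (m - 1) + q * v (m + 1).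
  move=> am; have := bal m; rewrite !vterm; try lia.
  by rewrite vE// -!EFinD => -[]; clear; lra.
pose z m := v m - green p q r a i0 m.
suff z0 : forall m, a <= m -> z m = 0.
  move=> an; rewrite vE//; congr (_%:E); apply: subr0_eq.
  exact: z0 (ltW an).
apply: (@bounded_balanced_eq0 _ p q r s a z (s^-1 + zeta p q r)) => //.
- by rewrite /z /v eqxx green_barrier// subrr.
- move=> m am; rewrite /z (le_trans (ler_normB _ _))// lerD//.
    rewrite /v; case: eqVneq => [_|ma]; first by rewrite normr0 invr_ge0 ltW.
    have [|x -> /andP[x0 xs]] := vfin m; first by lia.
    by rewrite /= ger0_norm.
  exact: (green_bound hp hq hs hsum).
- move=> m am; rewrite /z mulrBr vbal//.
  by rewrite (green_balance _ _ _ hp hq hs hsum); ring.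
Qed.

Theorem theorem3 (R : realType) (p q r s : R)
    (hp : 0 < p) (hq : 0 < q) (hs : 0 < s) (hr : 0 <= r)
    (hsum : p + q + r + s = 1)
    (a i0 : int) (hi0 : a < i0)
    (d : measure_display) (T : measurableType d) (P : probability T R)
    (X : nat -> T -> state)
    (hX : pqrs_walk p q r s (pred1 a) i0 P X) :
  [/\ absorption_prob P X a = expected_visits P X a,
      expected_visits P X a = (xi1 p q r ^ (a - i0))%:E
    & forall n : int, a < n ->
      [/\ absorption_prob P X n = (s%:E * expected_visits P X n)%E,
          n <= i0 ->
            expected_visits P X n =
            (zeta p q r * xi1 p q r ^ (a - i0)
             * (xi1 p q r ^ (n - a) - xi2 p q r ^ (n - a)))%:E
        & i0 <= n ->
            expected_visits P X n =
            (zeta p q r * xi2 p q r ^ (n - a)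
             * (xi2 p q r ^ (a - i0) - xi1 p q r ^ (a - i0)))%:E]].
Proof.
have [/andP[x20 _] x11] := xi_bounds hp hq hs hsum.
have x10 : xi1 p q r != 0 by rewrite gt_eqF// (lt_trans ltr01).
have abs n := absorption_visits n (ltW hs) hX.
split; first by rewrite abs /= eqxx mul1e.
  (* The barrier is entered from a + 1 only. *)
  rewrite (visits_balance a (ltW hp) (ltW hq) hr hX).
  rewrite (visits_below_barrier hi0 hX); last by lia.
  rewrite (lt_eqF hi0) /= eqxx mul0e mule0 !add0e (_ : (a + 1 == a) = false).
    rewrite (visits_eq_green hp hq hs hr hsum hi0 hX); last by lia.
    by rewrite -EFinM (green_next_barrier hp hq hs hsum hi0).
  by lia.
move=> n an; rewrite abs /= gt_eqF//; split=> //.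
- by move=> ni; rewrite (visits_eq_green hp hq hs hr hsum hi0 hX an) green_le.
- move=> ni; rewrite (visits_eq_green hp hq hs hr hsum hi0 hX an).
  by rewrite green_ge// gt_eqF.
Qed.
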